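(* Let $I$ be a finite or countable index set, $V=\bigoplus_{i\in I}V_i$ a direct sum of Hilbert spaces, $a:V\times V\to\mathbb C$ a continuous sesquilinear form, and $\alpha>0$. The following assertions are equivalent. (a) The form $(a,V)$ is coercive with constant $\alpha$. (b) For each finite $I'\subset I$ the restriction $a_{|I'}$ of the form $(a,V)$ induced by $I'$ is coercive with constant $\alpha$.
   Context: $I=\{1,\dots,m\}$ or $I=\mathbb N$. $V=\bigoplus_{i\in I}V_i=\{(\psi_i)_{i\in I}:\psi_i\in V_i,\ \sum_i\|\psi_i\|^2_{V_i}<\infty\}$ with scalar product $\sum_i(\psi_i\mid\psi'_i)_{V_i}$. For $I'\subset I$, $a_{|I'}$ denotes the restriction of $a$ to $V_{|I'}:=\prod_{i\in I'}V_i$, regarded as the subspace of $V$ of vectors whose components outside $I'$ vanish. A sesquilinear form $b$ on a Hilbert space $W$ is coercive with constant $\alpha$ if $\mathrm{Re}\,b(\psi,\psi)\ge\alpha\|\psi\|_W^2$ for all $\psi\in W$; it is continuous if $|b(\psi,\psi')|\le M\|\psi\|_W\|\psi'\|_W$ for some $M$. *)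

(* Defs.v *)
From HB Require Import structures.
From mathcomp Require Import all_boot all_order all_algebra finmap.
From mathcomp Require Import sesquilinear.
From mathcomp Require Import complex.
From mathcomp Require Import mathcomp_extra boolp classical_sets functions.
From mathcomp Require Import cardinality fsbigop reals ereal topology normedtype.
From mathcomp Require Import esum.
From mathcomp Require Import ring lra.

Set Implicit Arguments.
Unset Strict Implicit.
Unset Printing Implicit Defensive.

Import Order.TTheory GRing.Theory Num.Theory.
Import numFieldNormedType.Exports.
Local Open Scope classical_set_scope.
Local Open Scope ring_scope.
Local Open Scope complex_scope.

(* Complex Hilbert spaces. {dot V for Num.conj} is the library type of positive
   definite hermitian forms, linear in the first argument and antilinear in the
   second. A norm over R[i] takes its values in R[i] (in the nonnegative
   reals), and [x <= y] in R[i] entails that x and y have the same imaginary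
   part. *)
HB.mixin Record CompleteNormedModule_isHilbert (R : realType) V
    of CompleteNormedModule R[i] V := {
  hdot : {dot V for (@Num.conj R[i])};
  hdot_norm : forall x : V, `|x| ^+ 2 = hdot x x
}.

#[short(type="hilbertType")]
HB.structure Definition Hilbert (R : realType) :=
  {V of CompleteNormedModule R[i] V & CompleteNormedModule_isHilbert R V}.


(* Linear in the first argument, antilinear in the second. *)
Notation sesquilinear_form W :=
  {bilinear W -> W -> complex _ | *%R & (Num.conj \; *%R)}.

Section dot_theory.
Variables (R : realType) (U : lmodType R[i]).
Variable dot : {dot U for (@Num.conj R[i])}.

Lemma dot_CS (u v : U) : `|dot u v| ^+ 2 <= dot u u * dot v v.
Proof.
have [->|v0] := eqVneq v 0; first by rewrite !linear0r normr0 expr0n mulr0.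
have dv : dot v v != 0 by rewrite dnorm_eq0.
pose t := dot u v / dot v v; pose w := u - t *: v.
have wv : dot w v = 0 by rewrite linearBl/= linearZl_LR/= divfK ?subrr.
have uE : u = w + t *: v by rewrite subrK.
have uvE : dot u v = t * dot v v by rewrite divfK.
have duE : dot u u = dot w w + `|t| ^+ 2 * dot v v.
  by rewrite {1 2}uE hnormDd/= ?dnormZ// linearZr_LR/= wv mulr0.
rewrite uvE duE normrM exprMn (ger0_norm (dnorm_ge0 dot v)) mulrDl.
by rewrite expr2 -[_ * _ * dot v v]mulrA lerDr mulr_ge0 ?dnorm_ge0.
Qed.

Definition dot_norm (u : U) : R[i] := sqrtC (dot u u).

Lemma dot_norm_ge0 u : 0 <= dot_norm u.
Proof. by rewrite sqrtC_ge0 dnorm_ge0. Qed.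

Lemma dot_normD u v : dot_norm (u + v) <= dot_norm u + dot_norm v.
Proof.
rewrite -(@ler_sqr _ (dot_norm (u + v))) ?nnegrE ?addr_ge0 ?dot_norm_ge0//.
rewrite sqrrD !sqrtCK dnormD [leRHS]addrAC lerD2l.
have CS : `|dot u v| <= dot_norm u * dot_norm v.
  rewrite -(@ler_sqr _ `|_|) ?nnegrE ?mulr_ge0 ?dot_norm_ge0//.
  by rewrite exprMn !sqrtCK dot_CS.
have -> : dot u v + Num.conj (dot u v) = 'Re (dot u v) *+ 2.
  by rewrite ReE -mulr_natr divfK ?pnatr_eq0.
rewrite lerMn2r/= (le_trans _ CS)//.
exact: le_trans (real_ler_norm (Creal_Re _)) (leif_normC_Re_Creal _).
Qed.

Lemma dot_normZ (l : R[i]) u : dot_norm (l *: u) = `|l| * dot_norm u.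
Proof.
by rewrite /dot_norm dnormZ sqrtCM ?nnegrE ?exprn_ge0 ?dnorm_ge0// sqrCK.
Qed.

Lemma dot_norm_eq0 u : dot_norm u = 0 -> u = 0.
Proof. by move/eqP; rewrite sqrtC_eq0 dnorm_eq0 => /eqP. Qed.

End dot_theory.

Section nonneg_sum.
Variables (R : realType) (I : choiceType).
Implicit Types f g h k : I -> R.

(* Meaningful for f >= 0; the sum is finite exactly when nnfin f holds. *)
Definition nnsum f : R := fine (\esum_(i in setT) (f i)%:E).
Definition nnfin f := (\esum_(i in setT) (f i)%:E < +oo)%E.

Lemma nnfinE f : (forall i, 0 <= f i) -> nnfin f ->
  (nnsum f)%:E = \esum_(i in setT) (f i)%:E.
Proof.
move=> f0 ff; rewrite fineK// ge0_fin_numE//.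
by apply: esum_ge0 => i _; rewrite lee_fin.
Qed.

Lemma nnsumD f g : (forall i, 0 <= f i) -> (forall i, 0 <= g i) ->
  nnfin f -> nnfin g ->
  nnfin (fun i => f i + g i) /\ nnsum (fun i => f i + g i) = nnsum f + nnsum g.
Proof.
move=> f0 g0 ff gf.
have E : (\esum_(i in [set: I]) (f i + g i)%:E = (nnsum f + nnsum g)%:E)%E.
  rewrite EFinD !nnfinE// -esumD//; first by move=> *; rewrite lee_fin.
  by move=> *; rewrite lee_fin.
by rewrite /nnfin /nnsum E ltry.
Qed.

Lemma nnfin_le f g : (forall i, f i <= g i) -> nnfin g -> nnfin f.
Proof.
by move=> fg; apply: le_lt_trans; apply: le_esum => i _; rewrite lee_fin.
Qed.

Lemma nnsumZ c f : 0 <= c -> (forall i, 0 <= f i) -> nnfin f ->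
  nnfin (fun i => c * f i) /\ nnsum (fun i => c * f i) = c * nnsum f.
Proof.
move=> c0 f0 ff.
suff E : (\esum_(i in [set: I]) (c * f i)%:E = (c * nnsum f)%:E)%E.
  by rewrite /nnfin /nnsum E ltry.
rewrite EFinM nnfinE// /esum -ereal_supZl//; last first.
  by apply/set0P; exists 0%E; exists set0; [exact: fsets_set0|rewrite fsbig_set0].
congr ereal_sup; rewrite image_comp; apply: eq_imagel => A _ /=.
rewrite ge0_mule_fsumr// => i; rewrite lee_fin//.
Qed.

End nonneg_sum.

Section real_sum.
Variables (R : realType) (I : choiceType).
Implicit Types (f g h k : I -> R) (c : R).

(* Unconditional sum: positive part minus negative part. *)
Definition rsum f : R :=
  nnsum (fun i => Num.max (f i) 0) - nnsum (fun i => Num.max (- f i) 0).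

Definition rfin f := nnfin (fun i => `|f i|).

Lemma rfin_pos f : rfin f -> nnfin (fun i => Num.max (f i) 0).
Proof. by apply: nnfin_le => i; rewrite ge_max normr_ge0 ler_norm. Qed.

Lemma rfin_neg f : rfin f -> nnfin (fun i => Num.max (- f i) 0).
Proof. by apply: nnfin_le => i; rewrite ge_max normr_ge0 -normrN ler_norm. Qed.

Let max0 (x : R) : 0 <= Num.max x 0. Proof. by rewrite le_max lexx orbT. Qed.
Hint Resolve max0 : core.

Let posneg (x : R) : x = Num.max x 0 - Num.max (- x) 0.
Proof.
case: (leP 0 x) => x0; first by rewrite (max_r (_ : - x <= 0)) ?subr0 ?oppr_le0.
by rewrite max_l ?opprK ?add0r// oppr_ge0 ltW.
Qed.

Lemma rsumB g h : (forall i, 0 <= g i) -> (forall i, 0 <= h i) ->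
  nnfin g -> nnfin h -> rsum (fun i => g i - h i) = nnsum g - nnsum h.
Proof.
move=> g0 h0 gf hf.
have dfin : rfin (fun i => g i - h i).
  apply: nnfin_le (nnsumD g0 h0 gf hf).1 => i.
  by rewrite (le_trans (ler_normB _ _))// !ger0_norm.
have [_ E1] := nnsumD (fun i => max0 _) h0 (rfin_pos dfin) hf.
have [_ E2] := nnsumD g0 (fun i => max0 _) gf (rfin_neg dfin).
apply/eqP; rewrite /rsum subr_eq addrAC eq_sym subr_eq -E1 -E2; apply/eqP.
congr nnsum; apply/funext => i.
by rewrite [in X in _ = X + _](_ : Num.max _ _ = (g i - h i) + Num.max (- (g i - h i)) 0);
  [rewrite addrAC subrK|apply/eqP; rewrite -subr_eq -posneg].
Qed.

Lemma rfinD f g : rfin f -> rfin g -> rfin (fun i => f i + g i).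
Proof.
move=> ff gf; apply: nnfin_le (nnsumD (fun i => normr_ge0 (f i))
  (fun i => normr_ge0 (g i)) ff gf).1 => i; exact: ler_normD.
Qed.

Lemma rsumD f g : rfin f -> rfin g ->
  rsum (fun i => f i + g i) = rsum f + rsum g.
Proof.
move=> ff gf.
have [pf pE] := nnsumD (fun i => max0 _) (fun i => max0 _)
  (rfin_pos ff) (rfin_pos gf).
have [nf nE] := nnsumD (fun i => max0 _) (fun i => max0 _)
  (rfin_neg ff) (rfin_neg gf).
have -> : (fun i => f i + g i) = (fun i =>
    (Num.max (f i) 0 + Num.max (g i) 0) - (Num.max (- f i) 0 + Num.max (- g i) 0)).
  by apply/funext => i; rewrite opprD addrACA -!posneg.
rewrite rsumB// ?pE ?nE; last 2 first.
- by move=> i; rewrite addr_ge0.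
- by move=> i; rewrite addr_ge0.
by rewrite /rsum opprD addrACA.
Qed.

Lemma rsumN f : rsum (fun i => - f i) = - rsum f.
Proof.
rewrite /rsum opprB; congr (nnsum _ - _).
by congr nnsum; apply/funext => i; rewrite opprK.
Qed.

Lemma rfinN f : rfin f -> rfin (fun i => - f i).
Proof. by apply: nnfin_le => i; rewrite normrN. Qed.

Lemma rfinZ c f : rfin f -> rfin (fun i => c * f i).
Proof.
move=> ff; apply: nnfin_le (nnsumZ (normr_ge0 c)
  (fun i => normr_ge0 (f i)) ff).1 => i; by rewrite normrM.
Qed.

Let rsumZ0 c f : 0 <= c -> rfin f -> rsum (fun i => c * f i) = c * rsum f.
Proof.
move=> c0 ff; rewrite /rsum mulrBr.
rewrite -(nnsumZ c0 (fun i => max0 _) (rfin_pos ff)).2.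
rewrite -(nnsumZ c0 (fun i => max0 _) (rfin_neg ff)).2.
congr (_ - _); congr nnsum; apply/funext => i; by rewrite maxr_pMr// mulr0// mulrN.
Qed.

Lemma rsumZ c f : rfin f -> rsum (fun i => c * f i) = c * rsum f.
Proof.
move=> ff; have [c0|c0] := leP 0 c; first exact: rsumZ0.
rewrite (_ : (fun i => _) = (fun i => - ((- c) * f i))).
  by rewrite rsumN rsumZ0 ?oppr_ge0 1?ltW// mulNr opprK.
by apply/funext => i; rewrite mulNr opprK.
Qed.

Lemma rsum_ge0 f : (forall i, 0 <= f i) -> rsum f = nnsum f.
Proof.
move=> f0; rewrite /rsum.
rewrite (_ : (fun i => Num.max (f i) 0) = f); last first.
  by apply/funext => i; rewrite max_l.
rewrite (_ : (fun i => _) = (fun=> 0)) ?[nnsum (fun=> 0)]/nnsum ?esum1 ?subr0//.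
by apply/funext => i; rewrite max_r ?oppr_le0.
Qed.

End real_sum.

Section complex_sum.
Variables (R : realType) (I : choiceType).
Implicit Types z w : I -> R[i].

Definition csum z : R[i] :=
  rsum (fun i => complex.Re (z i)) +i* rsum (fun i => complex.Im (z i)).

Definition cfin z := nnfin (fun i => complex.Re `|z i|).

Lemma normr_Re (c : R[i]) : `|complex.Re c| <= complex.Re `|c|.
Proof.
case: c => a b; rewrite normc_def/= -sqrtr_sqr ler_wsqrtr// lerDl sqr_ge0//.
Qed.

Lemma normr_Im (c : R[i]) : `|complex.Im c| <= complex.Re `|c|.
Proof.
case: c => a b; rewrite normc_def/= -sqrtr_sqr ler_wsqrtr// lerDr sqr_ge0//.
Qed.

Lemma cfin_Re z : cfin z -> rfin (fun i => complex.Re (z i)).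
Proof. by apply: nnfin_le => i; exact: normr_Re. Qed.

Lemma cfin_Im z : cfin z -> rfin (fun i => complex.Im (z i)).
Proof. by apply: nnfin_le => i; exact: normr_Im. Qed.

Lemma csumD z w : cfin z -> cfin w ->
  csum (fun i => z i + w i) = csum z + csum w.
Proof.
move=> zf wf; rewrite /csum; simpc.
rewrite -rsumD ?cfin_Re// -rsumD ?cfin_Im//.
congr Complex; congr rsum; apply/funext => i; by case: (z i) (w i) => ? ? [].
Qed.

Lemma csumZ c z : cfin z -> csum (fun i => c * z i) = c * csum z.
Proof.
move=> zf; case: c => a b; rewrite /csum; simpc.
have fR := cfin_Re zf; have fI := cfin_Im zf.
rewrite -!rsumZ// -rsumN -!rsumD; do ?[exact: rfinZ|exact/rfinN/rfinZ|by []].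
congr Complex; congr rsum; apply/funext => i; by case: (z i).
Qed.

Lemma csum_conj z : csum (fun i => Num.conj (z i)) = Num.conj (csum z).
Proof.
rewrite /csum -[RHS]/(_ -i* _) -rsumN.
congr Complex; congr rsum; apply/funext => i; by case: (z i).
Qed.

Lemma csum_ge0 z (r : I -> R) : (forall i, 0 <= r i) ->
  (forall i, z i = (r i)%:C) -> csum z = (nnsum r)%:C.
Proof.
move=> r0 zr; rewrite /csum -rsum_ge0//; congr (_ +i* _).
  by congr rsum; apply/funext => i; rewrite zr.
rewrite rsum_ge0 => [|i]; last by rewrite zr.
by rewrite /nnsum esum1// => i _; rewrite zr.
Qed.

End complex_sum.

Section rnorm.
Variables (R : realType).

(* The norm as an element of R. *)
Definition rnorm (V : normedModType R[i]) (x : V) : R := complex.Re `|x|.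

Lemma rnormE (V : normedModType R[i]) (x : V) : `|x| = (rnorm x)%:C.
Proof. by rewrite /rnorm RRe_real// ger0_real. Qed.

Lemma rnorm_ge0 (V : normedModType R[i]) (x : V) : 0 <= rnorm x.
Proof. by rewrite -ler0c -rnormE. Qed.

Lemma rnorm0 (V : normedModType R[i]) : rnorm (0 : V) = 0.
Proof. by rewrite /rnorm normr0. Qed.

Lemma rnormN (V : normedModType R[i]) (x : V) : rnorm (- x) = rnorm x.
Proof. by rewrite /rnorm normrN. Qed.

Lemma rnormD (V : normedModType R[i]) (x y : V) :
  rnorm (x + y) <= rnorm x + rnorm y.
Proof. by rewrite -lecR rmorphD/= -!rnormE ler_normD. Qed.

Lemma rnormZ (V : normedModType R[i]) (c : R[i]) (x : V) :
  rnorm (c *: x) = complex.Re `|c| * rnorm x.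
Proof.
by apply: complexI; rewrite rmorphM/= -rnormE normrZ rnormE RRe_real// ger0_real.
Qed.

Lemma rnorm_eq0 (V : normedModType R[i]) (x : V) : rnorm x = 0 -> x = 0.
Proof. by move=> x0; apply/normr0_eq0; rewrite rnormE x0. Qed.

Lemma hdot_rnorm (V : hilbertType R) (x : V) :
  hdot x x = ((rnorm x) ^+ 2)%:C.
Proof. by rewrite -hdot_norm rnormE rmorphXn. Qed.

Lemma hdot_CS (V : hilbertType R) (x y : V) :
  complex.Re `|hdot x y| <= rnorm x * rnorm y.
Proof.
rewrite -lecR RRe_real ?ger0_real// -ler_sqr ?nnegrE// ?ler0c ?mulr_ge0 ?rnorm_ge0//.
rewrite (le_trans (dot_CS _ _ _))// !hdot_rnorm -rmorphM/= -exprMn rmorphXn/=.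
by [].
Qed.

End rnorm.

Section dsum.
Variables (R : realType) (I : choiceType) (V : I -> hilbertType R).

(* The Hilbert direct sum: the square-summable families. *)
Record dsum := DSum {
  dsval :> forall i, V i;
  dsvalP : (\esum_(i in setT) (rnorm (dsval i) ^+ 2)%:E < +oo)%E
}.

HB.instance Definition _ := gen_eqMixin dsum.
HB.instance Definition _ := gen_choiceMixin dsum.

Lemma dsumP (x y : dsum) : (forall i, x i = y i) -> x = y.
Proof.
case: x y => [x xP] [y yP] /= xy; have E : x = y by exact: functional_extensionality_dep.
by case: _ / E in yP *; congr DSum; exact: Prop_irrelevance.
Qed.

Definition sqf (x : forall i, V i) := fun i => rnorm (x i) ^+ 2.

Lemma sqf_ge0 x i : 0 <= sqf x i. Proof. exact: sqr_ge0. Qed.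

Lemma sqfD (x y : forall i, V i) : nnfin (sqf x) -> nnfin (sqf y) ->
  nnfin (sqf (fun i => x i + y i)).
Proof.
move=> xf yf.
have [s _] := nnsumD (sqf_ge0 x) (sqf_ge0 y) xf yf.
have [t _] := nnsumZ (ler0n R 2) (fun i => addr_ge0 (sqf_ge0 x i) (sqf_ge0 y i)) s.
apply: nnfin_le t => i; rewrite /sqf.
have h : rnorm (x i + y i) ^+ 2 <= (rnorm (x i) + rnorm (y i)) ^+ 2.
  by rewrite ler_sqr ?nnegrE ?addr_ge0 ?rnorm_ge0// rnormD.
by rewrite (le_trans h)//; have := sqr_ge0 (rnorm (x i) - rnorm (y i)); lra.
Qed.

Lemma sqfZ c (x : forall i, V i) : nnfin (sqf x) ->
  nnfin (sqf (fun i => c *: x i)).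
Proof.
move=> xf.
have [t _] := nnsumZ (sqr_ge0 (complex.Re `|c|)) (sqf_ge0 x) xf.
by apply: nnfin_le t => i; rewrite /sqf rnormZ exprMn.
Qed.

Lemma sqf0 : nnfin (sqf (fun i => 0)).
Proof.
by rewrite /nnfin esum1 ?ltry// => i _; rewrite /sqf rnorm0 expr0n.
Qed.

Lemma sqfN (x : forall i, V i) : nnfin (sqf x) ->
  nnfin (sqf (fun i => - x i)).
Proof. by apply: nnfin_le => i; rewrite /sqf rnormN. Qed.

Definition dsum0 := DSum sqf0.
Definition dsumD (x y : dsum) := DSum (sqfD (dsvalP x) (dsvalP y)).
Definition dsumN (x : dsum) := DSum (sqfN (dsvalP x)).
Definition dsumZ (c : R[i]) (x : dsum) := DSum (sqfZ c (dsvalP x)).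

Fact dsumA : associative dsumD.
Proof. by move=> x y z; apply: dsumP => i /=; rewrite addrA. Qed.
Fact dsumC : commutative dsumD.
Proof. by move=> x y; apply: dsumP => i /=; rewrite addrC. Qed.
Fact dsum0D : left_id dsum0 dsumD.
Proof. by move=> x; apply: dsumP => i /=; rewrite add0r. Qed.
Fact dsumND : left_inverse dsum0 dsumN dsumD.
Proof. by move=> x; apply: dsumP => i /=; rewrite addNr. Qed.

HB.instance Definition _ := GRing.isZmodule.Build dsum dsumA dsumC dsum0D dsumND.

Fact dsumZA a b v : dsumZ a (dsumZ b v) = dsumZ (a * b) v.
Proof. by apply: dsumP => i /=; rewrite scalerA. Qed.
Fact dsum1Z : left_id 1 dsumZ.
Proof. by move=> x; apply: dsumP => i /=; rewrite scale1r. Qed.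
Fact dsumZDr : right_distributive dsumZ +%R.
Proof. by move=> a x y; apply: dsumP => i /=; rewrite scalerDr. Qed.
Fact dsumZDl v : {morph dsumZ^~ v : a b / a + b}.
Proof. by move=> a b; apply: dsumP => i /=; rewrite scalerDl. Qed.

HB.instance Definition _ :=
  GRing.Zmodule_isLmodule.Build R[i] dsum dsumZA dsum1Z dsumZDr dsumZDl.

Definition dsum_dot (x y : dsum) : R[i] := csum (fun i => hdot (x i) (y i)).

Lemma cfin_dot (x y : dsum) : cfin (fun i => hdot (x i) (y i)).
Proof.
have [s _] := nnsumD (sqf_ge0 x) (sqf_ge0 y) (dsvalP x) (dsvalP y).
apply: nnfin_le s => i; rewrite (le_trans (hdot_CS _ _))// /sqf.
by have := rnorm_ge0 (x i); have := rnorm_ge0 (y i); nra.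
Qed.

Fact dsum_dotC (x y : dsum) : dsum_dot x y = (-1) ^+ false * Num.conj (dsum_dot y x).
Proof.
rewrite mul1r -csum_conj; congr csum; apply/funext => i.
by rewrite hermC mul1r.
Qed.

Fact dsum_dotDl (z : dsum) : zmod_morphism (dsum_dot^~ z).
Proof.
move=> x y; apply/eqP; rewrite eq_sym subr_eq eq_sym /dsum_dot; apply/eqP.
rewrite -csumD; do ?exact: cfin_dot.
by congr csum; apply/funext => i /=; rewrite -linearDl/= subrK.
Qed.

Fact dsum_dotZl (z : dsum) : scalable_for *%R (dsum_dot^~ z).
Proof.
move=> a x; rewrite /dsum_dot -csumZ; last exact: cfin_dot.
by congr csum; apply/funext => i /=; rewrite linearZl_LR.
Qed.

Fact dsum_dotDr (z : dsum) : zmod_morphism (dsum_dot z).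
Proof.
move=> x y; rewrite dsum_dotC mul1r dsum_dotDl rmorphB/=.
by rewrite [in RHS]dsum_dotC [dsum_dot z y]dsum_dotC !mul1r.
Qed.

Fact dsum_dotZr (z : dsum) : scalable_for (Num.conj \; *%R) (dsum_dot z).
Proof.
move=> a x; rewrite dsum_dotC mul1r dsum_dotZl rmorphM/=.
by rewrite [in RHS]dsum_dotC !mul1r.
Qed.

HB.instance Definition _ := isBilinear.Build R[i] dsum dsum R[i]
  *%R (Num.conj \; *%R) dsum_dot dsum_dotDl dsum_dotDr dsum_dotZl dsum_dotZr.

HB.instance Definition _ :=
  isHermitianSesquilinear.Build R[i] dsum false Num.conj dsum_dot dsum_dotC.

Lemma dsum_dotxx (x : dsum) : dsum_dot x x = (nnsum (sqf x))%:C.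
Proof. by apply: csum_ge0 => i; [exact: sqf_ge0|exact: hdot_rnorm]. Qed.

Lemma le_nnsum (J : set I) (f : I -> R) : finite_set J -> (forall i, 0 <= f i) ->
  nnfin f -> \sum_(i \in J) f i <= nnsum f.
Proof.
move=> Jfin f0 ff; rewrite -lee_fin nnfinE// -fsumEFin//.
by apply: esum_ge; exists J.
Qed.

Lemma rnorm_le_nnsum (x : dsum) i : rnorm (x i) ^+ 2 <= nnsum (sqf x).
Proof.
have := le_nnsum (finite_set1 i) (sqf_ge0 x) (dsvalP x).
by rewrite fsbig_set1.
Qed.

Fact dsum_dot_gt0 (x : dsum) : x != 0 -> 0 < dsum_dot x x.
Proof.
move=> x0; rewrite dsum_dotxx ltcR lt_neqAle; apply/andP; split; last first.
  by apply: fine_ge0; apply: esum_ge0 => i _; rewrite lee_fin sqf_ge0.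
apply/eqP => s0; move/eqP: x0; apply; apply: dsumP => i /=.
apply: rnorm_eq0; apply/eqP; rewrite -sqrf_eq0 eq_le sqr_ge0 andbT.
by rewrite s0 rnorm_le_nnsum.
Qed.

HB.instance Definition _ := isDotProduct.Build R[i] dsum dsum_dot dsum_dot_gt0.

(* The norm is the one induced by dsum_dot; see dsum_norm and rnorm_dsum. *)
HB.instance Definition _ := Lmodule_isNormed.Build R[i] dsum
  (@dot_normD R dsum dsum_dot) (@dot_normZ R dsum dsum_dot)
  (@dot_norm_eq0 R dsum dsum_dot).

Fact dsum_norm (x : dsum) : `|x| ^+ 2 = dsum_dot x x.
Proof. exact: (sqrtCK (dsum_dot x x)). Qed.

Lemma rnorm_dsum (x : dsum) : rnorm x ^+ 2 = nnsum (sqf x).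
Proof. by apply: complexI; rewrite rmorphXn/= -rnormE dsum_norm dsum_dotxx. Qed.

End dsum.

Section dsum_complete.
Variables (R : realType) (I : choiceType) (V : I -> hilbertType R).
Local Notation dsum := (dsum V).

Lemma rnorm_proj (x : dsum) i : rnorm (x i) <= rnorm x.
Proof. by rewrite -ler_sqr ?nnegrE ?rnorm_ge0// rnorm_dsum rnorm_le_nnsum. Qed.

Lemma rnorm_ltc (W : normedModType R[i]) (x : W) (e : R) :
  (`|x| < e%:C) = (rnorm x < e).
Proof. by rewrite rnormE ltcR. Qed.

Lemma rnorm_dist (W : normedModType R[i]) (x y : W) :
  `|rnorm x - rnorm y| <= rnorm (x - y).
Proof.
rewrite ler_norml; apply/andP; split.
  rewrite lerNl opprB lerBlDr -[rnorm (x - y)]rnormN opprB.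
  by rewrite (le_trans _ (rnormD _ _))// subrK.
by rewrite lerBlDr (le_trans _ (rnormD _ _))// subrK.
Qed.

Lemma near_rnorm (F : set_system dsum) : ProperFilter F -> cauchy F ->
  forall e : R, 0 < e -> exists2 A, F A & forall x y, A x -> A y ->
    rnorm (x - y) < e.
Proof.
move=> FF /cauchy_ballP cF e e0.
have e20 : 0 < (e / 2)%:C by rewrite ltcR divr_gt0.
have [[A B] /= [FA FB] AB] := cF _ e20.
exists (A `&` B); first exact: filterI.
move=> x y [Ax Bx] [Ay By].
have [z [Az Bz]] : (A `&` B) !=set0 by exact: filter_ex (filterI FA FB).
have xz := AB (z, x) (conj Az Bx); have yz := AB (z, y) (conj Az By).
move: xz yz; rewrite /= -!ball_normE /= !rnorm_ltc => xz yz.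
have -> : x - y = (z - y) - (z - x) by rewrite opprB [RHS]addrC subrKA.
by rewrite (le_lt_trans (rnormD _ _))// rnormN [ltRHS]splitr ltrD.
Qed.

Lemma near_proj (F : set_system dsum) : ProperFilter F -> cauchy F ->
  forall i, exists l : V i, forall e : R, 0 < e ->
    F [set x : dsum | rnorm (x i - l) < e].
Proof.
move=> FF cF i; pose G := (fun x : dsum => x i) @ F.
have GF : ProperFilter G by exact: fmap_proper_filter.
have : cvg G.
  apply: cauchy_cvg; apply/cauchy_ballP => e e0.
  have eE : e = (complex.Re e)%:C by rewrite RRe_real// gtr0_real.
  have e0' : 0 < complex.Re e by rewrite -ltcR -eE.
  have [A FA AP] := near_rnorm FF cF e0'.
  exists ((fun x : dsum => x i) @` A, (fun x : dsum => x i) @` A) => /=.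
    by split; apply: (@filterS dsum F _ A _ _ FA) => x Ax; exists x.
  move=> [_ _] /= [[x Ax <-] [y Ay <-]].
  rewrite -ball_normE/= eE rnorm_ltc (le_lt_trans _ (AP x y Ax Ay))//.
  exact: (rnorm_proj (x - y)).
move=> cG; exists (lim G) => e e0.
have ec0 : 0 < e%:C by rewrite ltcR.
have : nbhs (lim G) (ball (lim G) e%:C) by exact: (nbhsx_ballx _ _ ec0).
move/cG; rewrite /G/= => h; apply: (@filterS dsum F _ _ _ _ h) => x /=.
by rewrite -ball_normE/= rnorm_ltc -rnormN opprB.
Qed.

Lemma cvg_sum_seq (T : Type) (F : set_system T) (FF : Filter F) (s : seq I)
    (f : T -> I -> R) (g : I -> R) : (forall i, f^~ i @ F --> g i) ->
  (fun y => \sum_(i <- s) f y i) @ F --> \sum_(i <- s) g i.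
Proof.
move=> fg; elim: s => [|i s IH].
  rewrite big_nil (_ : (fun _ => _) = fun=> 0); first exact: cvg_cst.
  by apply/funext => y; rewrite big_nil.
rewrite big_cons (_ : (fun _ => _) = fun y => f y i + \sum_(j <- s) f y j).
  exact: cvgD.
by apply/funext => y; rewrite big_cons.
Qed.

Lemma fsum_limit (F : set_system dsum) : ProperFilter F -> cauchy F ->
  forall l : (forall i, V i),
  (forall i (e : R), 0 < e -> F [set x : dsum | rnorm (x i - l i) < e]) ->
  forall (e : R), 0 < e -> exists2 A, F A & forall x : dsum, A x ->
    forall J : set I, finite_set J ->
      \sum_(i \in J) sqf (fun i => x i - l i) i <= e ^+ 2.
Proof.
move=> FF cF l lP e e0; have [A FA AP] := near_rnorm FF cF e0.
exists A => // x Ax J Jfin.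
have cv i : (fun y : dsum => sqf (fun i => x i - y i) i) @ F -->
    sqf (fun i => x i - l i) i.
  suff h : (fun y : dsum => rnorm (x i - y i)) @ F --> rnorm (x i - l i).
    by apply: cvgM.
  apply/cvgrPdist_lt => d d0; apply: filterS (lP i d d0) => y /=.
  apply: le_lt_trans; apply: le_trans (rnorm_dist _ _) _.
  by rewrite opprB [X in rnorm X <= _]addrC subrKA.
have cvs : (fun y : dsum => \sum_(i \in J) sqf (fun i => x i - y i) i) @ F -->
    \sum_(i \in J) sqf (fun i => x i - l i) i.
  rewrite fsbig_finite//=; under eq_fun do rewrite fsbig_finite//=.
  exact: cvg_sum_seq.
apply: (cvgr_to_le cvs); apply: filterS FA => y Ay.
apply: (le_trans (le_nnsum Jfin (sqf_ge0 _) (dsvalP (x - y)))).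
by rewrite -rnorm_dsum ler_sqr ?nnegrE ?rnorm_ge0 1?ltW ?AP.
Qed.

Fact dsum_cauchy_cvg (F : set_system dsum) : ProperFilter F -> cauchy F -> cvg F.
Proof.
move=> FF cF.
pose l i := sval (cid (near_proj FF cF i)).
have lP i e : 0 < e -> F [set x : dsum | rnorm (x i - l i) < e].
  exact: (svalP (cid (near_proj FF cF i))).
have key := fsum_limit FF cF lP.
have ubd e : 0 < e -> exists2 A, F A & forall x : dsum, A x ->
    (\esum_(i in setT) (sqf (fun i => x i - l i) i)%:E <= (e ^+ 2)%:E)%E.
  move=> /key[A FA AP]; exists A => // x /AP xP.
  apply: ge_ereal_sup => _ [J [Jfin _] <-].
  by rewrite fsumEFin// lee_fin xP.
have lfin : nnfin (sqf l).
  have [A FA AP] := ubd _ ltr01.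
  have [x /AP xl] := filter_ex FA.
  have := sqfD (sqfN (le_lt_trans xl (ltry _))) (dsvalP x).
  by apply: nnfin_le => i; rewrite /sqf opprB subrK.
pose L := DSum lfin; apply/cvg_ex; exists L; apply/cvg_ballP => e e0.
have eE : e = (complex.Re e)%:C by rewrite RRe_real// gtr0_real.
have e20 : 0 < complex.Re e / 2 by rewrite divr_gt0// -ltcR -eE.
have [A FA AP] := ubd _ e20; apply: filterS FA => x /AP xl.
rewrite -ball_normE/= eE rnorm_ltc -rnormN opprB.
rewrite (@le_lt_trans _ _ (complex.Re e / 2))//; last first.
  by rewrite ltr_pdivrMr// ltr_pMr ?ltr1n// -ltcR -eE.
rewrite -ler_sqr ?nnegrE ?rnorm_ge0 ?(ltW e20)// rnorm_dsum -lee_fin nnfinE//.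
  exact: sqf_ge0.
exact: le_lt_trans xl (ltry _).
Qed.

HB.instance Definition _ := Uniform_isComplete.Build dsum dsum_cauchy_cvg.

HB.instance Definition _ :=
  CompleteNormedModule_isHilbert.Build R dsum (@dsum_norm R I V).

Lemma dsum_hdotE (x y : dsum) : hdot x y = csum (fun i => hdot (x i) (y i)).
Proof. by []. Qed.

End dsum_complete.

Section restriction.
Variables (R : realType) (I : choiceType) (V : I -> hilbertType R).
Variable J : {fset I}.

(* For finite J, square-summability is vacuous and dsum_fset is the product of
   the V i, i in J; extend0 realizes it as the subspace of dsum V of the
   families that vanish outside J. *)
Definition dsum_fset := dsum (fun j : J => V (val j)).

Definition extend0_fun (x : dsum_fset) (i : I) : V i :=
  if pselect (i \in J) is left iJ then x [` iJ]%fset else 0.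

Fact extend0_subproof (x : dsum_fset) :
  (\esum_(i in setT) (rnorm (extend0_fun x i) ^+ 2)%:E < +oo)%E.
Proof.
have -> : \esum_(i in setT) (rnorm (extend0_fun x i) ^+ 2)%:E =
    \esum_(i in [set` J]) (rnorm (extend0_fun x i) ^+ 2)%:E.
  rewrite [RHS]esum_mkcond; apply: eq_esum => i _; case: ifPn => //.
  rewrite notin_setE/= => iJ; rewrite /extend0_fun.
  by case: pselect => [/[dup]/iJ//|_]; rewrite rnorm0 expr0n.
by rewrite esum_fset ?fsumEFin ?ltry// => i _; rewrite lee_fin sqr_ge0.
Qed.

Definition extend0 (x : dsum_fset) : dsum V := DSum (extend0_subproof x).

Fact extend0_linear : linear extend0.
Proof.
move=> c x y; apply: dsumP => i /=; rewrite /extend0_fun.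
by case: pselect => [//|_]; rewrite scaler0 addr0.
Qed.

HB.instance Definition _ :=
  GRing.isLinear.Build R[i] dsum_fset (dsum V) _ extend0 extend0_linear.

Definition restrict_form (a : dsum V -> dsum V -> R[i]) (x y : dsum_fset) : R[i] :=
  a (extend0 x) (extend0 y).

Variable a : sesquilinear_form (dsum V).

Fact restrict_bilinear : bilinear_for *%R (Num.conj \; *%R) (restrict_form a).
Proof.
split=> [z c x y|z c x y]; rewrite /restrict_form linearP.
  by rewrite linearDl linearZl_LR.
by rewrite linearDr linearZr_LR.
Qed.

HB.instance Definition _ := bilinear_isBilinear.Build R[i] dsum_fset dsum_fset
  R[i] *%R (Num.conj \; *%R) (restrict_form a) restrict_bilinear.

End restriction.
Arguments restrict_form {R I V} J a x y.

Section forms.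
Variables (R : realType) (W : hilbertType R).

Definition form_continuous (b : sesquilinear_form W) :=
  exists M : R, forall x y : W, `|b x y| <= M%:C * `|x| * `|y|.

(* Both sides are real elements of R[i], so this is an inequality in R. *)
Definition coercive (alpha : R) (b : sesquilinear_form W) :=
  forall x : W, alpha%:C * `|x| ^+ 2 <= 'Re (b x x).
End forms.

(* Main.v *)
Require Import Defs.
From mathcomp Require Import all_boot all_order all_algebra finmap.
From mathcomp Require Import complex.
From mathcomp Require Import boolp classical_sets reals topology normedtype.
From mathcomp Require Import cardinality fsbigop.
From mathcomp Require Import ereal esum lra.

Set Implicit Arguments.
Unset Strict Implicit.
Unset Printing Implicit Defensive.

Import Order.TTheory GRing.Theory Num.Theory.
Local Open Scope ring_scope.
Local Open Scope complex_scope.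

(** Extension by zero embeds the finite direct sum over J isometrically in V
    ([rnorm_extend0]), and the restricted form is the form a read through this
    embedding, so coercivity of a passes to every restriction with the same
    constant.

    Conversely, coercivity of all the restrictions says that
    alpha * |z|^2 <= Re a(z, z) for every z with finite support.  Such vectors
    are dense in V: the tails of the convergent sum of the |x_i|^2 are
    arbitrarily small ([finite_support_dense]).  Both sides of the inequality
    are continuous in z, the right one because a is a bounded form, so it holds
    on all of V ([coercive_dense]). *)

(** The order of R[i] is awkward to compute with; this is coercivity as an
    inequality between real numbers. *)
Lemma coerciveE (R : realType) (W : hilbertType R) (alpha : R)
    (b : sesquilinear_form W) :
  coercive alpha b <->
  forall x : W, alpha * rnorm x ^+ 2 <= complex.Re (b x x).
Proof.
by split=> h x; move: (h x);
  rewrite -complexRe rnormE -rmorphXn/= -rmorphM/= lecR.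
Qed.

(** Nothing forces the constant of a bounded form to be nonnegative when the
    space is trivial; enlarging it to its absolute value makes the bound usable
    in estimates. *)
Lemma form_continuous_bound (R : realType) (W : hilbertType R)
    (b : sesquilinear_form W) : form_continuous b ->
  exists2 M : R, 0 <= M &
    forall x y : W, `|complex.Re (b x y)| <= M * (rnorm x * rnorm y).
Proof.
move=> [M bM]; exists `|M| => // x y.
apply: le_trans (normr_Re _) _; rewrite -lecR RRe_real ?ger0_real//.
apply: le_trans (bM x y) _; rewrite !rnormE -!rmorphM/= lecR -mulrA.
by rewrite ler_wpM2r ?mulr_ge0 ?rnorm_ge0// ler_norm.
Qed.

(** The inequality of coercivity is a closed condition.  Quantitatively, with
    h := x - z and N := |x|, passing from x to z lowers alpha * |.|^2 by at most
    2 alpha N |h|, and raises Re b(., .) by at most M (2 N |h| + |h|^2), so the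
    loss is of order |h|. *)
Lemma coercive_dense (R : realType) (W : hilbertType R) (alpha : R)
    (b : sesquilinear_form W) (D : W -> Prop) :
  0 <= alpha -> form_continuous b ->
  (forall (x : W) (e : R), 0 < e -> exists2 z, D z & rnorm (x - z) < e) ->
  (forall z, D z -> alpha * rnorm z ^+ 2 <= complex.Re (b z z)) ->
  coercive alpha b.
Proof.
move=> alpha0 /form_continuous_bound[M M0 bM] dense bD; apply/coerciveE => x.
apply/ler_addgt0Pr => e e0; set N := rnorm x.
have N0 : 0 <= N by exact: rnorm_ge0.
(* For |h| <= 1 the total loss is at most (2 (alpha + M) N + M) * |h|; the
   extra 1 makes C positive, so that z can be taken within e / C of x. *)
pose C := 2 * (alpha + M) * N + M + 1.
have C0 : 0 < C.
  by rewrite ltr_wpDl ?ltr01// addr_ge0// !mulr_ge0// addr_ge0.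
have d0 : 0 < Num.min 1 (e / C) by rewrite lt_min ltr01 divr_gt0.
have [z Dz] := dense x _ d0; rewrite lt_min; set h := x - z.
move=> /andP[h1 /ltW]; rewrite ler_pdivlMr// => hC.
have h0 : 0 <= rnorm h by exact: rnorm_ge0.
have zE : z = x - h by rewrite /h subKr.
have NN : N * (N - 2 * rnorm h) <= rnorm z ^+ 2.
  have Nz : N <= rnorm z + rnorm h by have := rnormD z h; rewrite /h addrC subrK.
  (* Squaring N - |h| <= |z| is only sound when N - |h| is nonnegative; when
     N <= 2 |h| the left-hand side is nonpositive anyway. *)
  have [Nh|hN] := leP N (2 * rnorm h).
    by apply: le_trans (sqr_ge0 _); rewrite mulr_ge0_le0// subr_le0.
  have : (N - rnorm h) ^+ 2 <= rnorm z ^+ 2.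
    by rewrite ler_sqr ?nnegrE ?rnorm_ge0//; lra.
  by have := sqr_ge0 (rnorm h); lra.
have bzz : complex.Re (b z z) <=
    complex.Re (b x x) + M * (2 * N * rnorm h + rnorm h ^+ 2).
  have -> : b z z = b x x - b x h - (b h x - b h h).
    by rewrite zE linearBl/= !linearBr.
  have := bM x h; have := bM h x; have := bM h h; rewrite !raddfB/= !ler_norml.
  rewrite -/N; lra.
have azz := bD z Dz.
have aNN : alpha * (N * (N - 2 * rnorm h)) <= alpha * rnorm z ^+ 2.
  by rewrite ler_wpM2l.
have hh : M * rnorm h ^+ 2 <= M * rnorm h by rewrite ler_wpM2l//; nra.
by move: hC; rewrite /C; lra.
Qed.

Section truncation.
Variables (R : realType) (I : choiceType).

Lemma nnfin_finType (T : finType) (f : T -> R) : (forall t, 0 <= f t) -> nnfin f.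
Proof.
move=> f0; rewrite /nnfin (esum_fset finite_finset) => [|t _].
  by rewrite fsumEFin ?ltry//; exact: finite_finset.
by rewrite lee_fin.
Qed.

Lemma esum_fset_support (J : {fset I}) (f : I -> \bar R) :
  (forall i, i \notin J -> f i = 0%E) ->
  \esum_(i in [set: I]) f i = \esum_(j in [set: J]) f (val j).
Proof.
move=> fJ; rewrite -(@reindex_esum _ _ _ [set: J] [set` J] val); last first.
  split=> [j _ /=|i j _ _ /val_inj//|i /= iJ]; first exact: valP.
  by exists [` iJ]%fset.
rewrite [RHS]esum_mkcond; apply: eq_esum => i _.
by case: ifPn => //; rewrite notin_setE/= => /negP/fJ.
Qed.

Variable V : I -> hilbertType R.
Variable J : {fset I}.

Definition truncate (x : dsum V) : dsum_fset V J :=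
  @DSum _ _ (fun j : J => V (val j)) (fun j => x (val j))
    (nnfin_finType (fun j => sqr_ge0 (rnorm (x (val j))))).

Lemma extend0_in (x : dsum_fset V J) (j : J) : extend0 x (val j) = x j.
Proof.
case: j => i iJ; rewrite /= /extend0_fun; case: pselect => [iJ'|/(_ iJ)//].
by rewrite (bool_irrelevance iJ' iJ).
Qed.

Lemma extend0_out (x : dsum_fset V J) (i : I) : i \notin J -> extend0 x i = 0.
Proof.
by move=> iJ; rewrite /= /extend0_fun; case: pselect => // iJ'; case/negP: iJ.
Qed.

Lemma rnorm_extend0 (x : dsum_fset V J) : rnorm (extend0 x) = rnorm x.
Proof.
apply: (pexpIrn (n := 2)); rewrite ?nnegrE ?rnorm_ge0//.
rewrite !rnorm_dsum /nnsum (esum_fset_support (J := J)); last first.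
  by move=> i iJ; rewrite /sqf extend0_out// rnorm0 expr0n.
by congr fine; apply: eq_esum => j _; rewrite /sqf extend0_in.
Qed.

Lemma extend0_truncate (x : dsum V) (i : I) :
  extend0 (truncate x) i = if i \in J then x i else 0.
Proof.
case: ifPn => [iJ|]; last exact: extend0_out.
exact: (extend0_in (truncate x) [` iJ]%fset).
Qed.

(** The truncation and the remainder have disjoint supports: this is
    Pythagoras' identity for them, coordinate by coordinate. *)
Lemma sqf_truncate (x : dsum V) (i : I) :
  sqf x i = sqf (extend0 (truncate x)) i + sqf (x - extend0 (truncate x)) i.
Proof.
have -> : sqf (x - extend0 (truncate x)) i =
  rnorm (x i - extend0 (truncate x) i) ^+ 2 by [].
rewrite /sqf extend0_truncate; case: ifP => _.
  by rewrite subrr rnorm0 expr0n addr0.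
by rewrite subr0 rnorm0 expr0n add0r.
Qed.

End truncation.

(** The sum of the |x_i|^2 is the supremum of its finite partial sums; take J
    for which the partial sum is within e^2 of it.  By Pythagoras the difference
    is the squared norm of the remainder. *)
Lemma finite_support_dense (R : realType) (I : choiceType)
    (V : I -> hilbertType R) (x : dsum V) (e : R) : 0 < e ->
  exists J : {fset I}, rnorm (x - extend0 (truncate J x)) < e.
Proof.
move=> e0; have S_fin := nnfinE (sqf_ge0 x) (dsvalP x).
have [_ [A [Afin _] <-]] : exists2 s,
    [set \sum_(i \in B) (sqf x i)%:E | B in fsets [set: I]]%classic%E s &
    ((nnsum (sqf x) - e ^+ 2)%:E < s)%E.
  apply/ereal_sup_gt; rewrite -[X in (_ < X)%E]S_fin lte_fin ltrBlDr.
  by rewrite ltrDl exprn_gt0.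
rewrite fsumEFin// lte_fin => SA; exists (fset_set A).
set z := extend0 _.
have [_] := nnsumD (sqf_ge0 z) (sqf_ge0 (x - z)) (dsvalP z) (dsvalP (x - z)).
have -> : (fun i => sqf z i + sqf (x - z) i) = sqf x.
  by apply/funext => i; rewrite [RHS](sqf_truncate (fset_set A)).
move=> S_split.
have zA : \sum_(i \in A) sqf x i <= nnsum (sqf z).
  apply: le_trans (le_nnsum Afin (sqf_ge0 z) (dsvalP z)).
  rewrite le_eqVlt; apply/orP; left; apply/eqP; apply: eq_fsbigr => i iA.
  by rewrite /sqf extend0_truncate in_fset_set// iA.
rewrite -ltr_sqr ?nnegrE ?rnorm_ge0 ?(ltW e0)// rnorm_dsum.
lra.
Qed.

Theorem theorem16 (R : realType) (I : countType) (V : I -> hilbertType R)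
    (a : sesquilinear_form (dsum V)) (a_cont : form_continuous a)
    (alpha : R) (alpha_gt0 : 0 < alpha) :
  coercive alpha a <->
  (forall J : {fset I}, coercive alpha (restrict_form J a)).
Proof.
split=> [/coerciveE aV J|aJ].
  by apply/coerciveE => x; rewrite -rnorm_extend0; exact: aV.
apply: (coercive_dense (D := fun z => exists J (y : dsum_fset V J), z = extend0 y)).
- exact: ltW.
- exact: a_cont.
- move=> x e /(finite_support_dense x)[J xJ].
  by exists (extend0 (truncate J x)) => //; exists J, (truncate J x).
- move=> _ [J [y ->]]; rewrite rnorm_extend0.
  by have /coerciveE/(_ y) := aJ J.
Qed.
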